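(* Let $\mathcal{S},\mathcal{U},\mathcal{A}$ be nonempty finite sets, let $f:\mathcal{S}\times\mathcal{U}\times\mathcal{A}\to\mathcal{S}$ and $h:\mathcal{S}\to\mathbb{R}$ be functions, and let $0<\gamma_h<1$. Let $T_h^{\pi}$ (for $\pi:\mathcal{S}\to\mathcal{U}$) and $T_h$ be the safety self-consistency operators defined in the context. Let $\pi_0:\mathcal{S}\to\mathcal{U}$ be an arbitrary initial policy and let $\{\pi_k\}_{k\ge0}$, $\{V_h^{\pi_k}\}_{k\ge0}$ be any sequences generated by the policy iteration algorithm described in the context. Then the sequence $\{V_h^{\pi_k}\}$ is monotonically nondecreasing, i.e. $V_h^{\pi_k}(x)\le V_h^{\pi_{k+1}}(x)$ for all $k\ge0$ and $x\in\mathcal{S}$, and it converges to the fixed point $V_h^*\in\mathbb{R}^{|\mathcal{S}|}$ of $T_h$, i.e. to the vector satisfying $T_h(V_h^* )=V_h^*$.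
   Context: The setting is a discrete-time system $x_{t+1}=f(x_t,u_t,a_t)$ with state space $\mathcal{S}$, control inputs $u\in\mathcal{U}$, disturbances $a\in\mathcal{A}$, and constraint function $h$. Functions $V_h:\mathcal{S}\to\mathbb{R}$ are identified with vectors in $\mathbb{R}^{|\mathcal{S}|}$. The safety self-consistency operators are defined for $V_h\in\mathbb{R}^{|\mathcal{S}|}$, $x\in\mathcal{S}$ and a policy $\pi:\mathcal{S}\to\mathcal{U}$ by $$[T_h^{\pi}(V_h)](x)=(1-\gamma_h)h(x)+\gamma_h\min\left\{h(x),\,\min_{a\in\mathcal{A}}V_h\big(f(x,\pi(x),a)\big)\right\},$$ $$[T_h(V_h)](x)=(1-\gamma_h)h(x)+\gamma_h\min\left\{h(x),\,\max_{u\in\mathcal{U}}\min_{a\in\mathcal{A}}V_h\big(f(x,u,a)\big)\right\}.$$ Each of these operators has a unique fixed point in $\mathbb{R}^{|\mathcal{S}|}$ (it is a $\gamma_h$-contraction in the sup norm). Policy iteration algorithm: starting from $\pi_0$, for each $k=0,1,2,\dots$, (i) (policy evaluation) let $V_h^{\pi_k}\in\mathbb{R}^{|\mathcal{S}|}$ be the solution of $V_h^{\pi_k}=T_h^{\pi_k}(V_h^{\pi_k})$; (ii) (policy improvement) let $\pi_{k+1}\in\arg\max_{\pi}\,T_h^{\pi}(V_h^{\pi_k})$, where the maximization is componentwise: $\pi_{k+1}:\mathcal{S}\to\mathcal{U}$ is any policy such that $[T_h^{\pi_{k+1}}(V_h^{\pi_k})](x)\ge[T_h^{\pi}(V_h^{\pi_k})](x)$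 for all $x\in\mathcal{S}$ and all policies $\pi:\mathcal{S}\to\mathcal{U}$. Here $V_h^{\pi_k}$ and $V_h^*$ denote the fixed points of the discounted operators $T_h^{\pi_k}$ and $T_h$. *)

(* Defs.v *)
From mathcomp Require Import all_boot all_order all_algebra.
From mathcomp Require Import all_classical all_reals all_analysis.
Set Implicit Arguments.
Unset Strict Implicit.
Unset Printing Implicit Defensive.
Import Order.TTheory GRing.Theory Num.Theory.
Import numFieldNormedType.Exports.

Local Open Scope ring_scope.

(* R has no least or greatest element to serve as the value of an empty
   min or max, so the iterated operators start from the value at an inhabitant
   t0 of T. The results do not depend on t0: see fin_minP and fin_maxP. *)
Definition fin_min (R : realType) (T : finType) (t0 : T) (F : T -> R) : R :=
  \big[Order.min/F t0]_(t : T) F t.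

Definition fin_max (R : realType) (T : finType) (t0 : T) (F : T -> R) : R :=
  \big[Order.max/F t0]_(t : T) F t.

Lemma fin_minP (R : realType) (T : finType) (t0 : T) (F : T -> R) (m : R) :
  fin_min t0 F = m <-> (exists t, F t = m) /\ (forall t, m <= F t).
Proof.
have lb t : fin_min t0 F <= F t by exact: bigmin_le.
have [t1 tE] : exists t, F t = fin_min t0 F.
  rewrite /fin_min; elim/big_ind: _ => [|x y [i <-] [j <-]|i _].
  - by exists t0.
  - by case: (leP (F i) (F j)) => _; [exists i | exists j].
  - by exists i.
split=> [<-|[[t <-] mle]]; first by split=> //; exists t1.
by apply/eqP; rewrite eq_le lb -tE mle.
Qed.

Lemma fin_maxP (R : realType) (T : finType) (t0 : T) (F : T -> R) (m : R) :
  fin_max t0 F = m <-> (exists t, F t = m) /\ (forall t, F t <= m).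
Proof.
have ub t : F t <= fin_max t0 F by exact: le_bigmax.
have [t1 tE] : exists t, F t = fin_max t0 F.
  rewrite /fin_max; elim/big_ind: _ => [|x y [i <-] [j <-]|i _].
  - by exists t0.
  - by case: (leP (F i) (F j)) => _; [exists j | exists i].
  - by exists i.
split=> [<-|[[t <-] mge]]; first by split=> //; exists t1.
by apply/eqP; rewrite eq_le ub -tE mge.
Qed.

Definition T_policy (R : realType) (S U A : finType) (a0 : A)
    (f : S -> U -> A -> S) (h : S -> R) (gamma : R) (pi : S -> U)
    (V : S -> R) : S -> R :=
  fun x => (1 - gamma) * h x +
    gamma * Order.min (h x) (fin_min a0 (fun a => V (f x (pi x) a))).

Definition T_safe (R : realType) (S U A : finType) (u0 : U) (a0 : A)
    (f : S -> U -> A -> S) (h : S -> R) (gamma : R) (V : S -> R) : S -> R :=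
  fun x => (1 - gamma) * h x +
    gamma * Order.min (h x)
      (fin_max u0 (fun u => fin_min a0 (fun a => V (f x u a)))).

(* pi' is in the componentwise argmax over policies of T^pi (V). *)
Definition improving_policy (R : realType) (S U A : finType) (a0 : A)
    (f : S -> U -> A -> S) (h : S -> R) (gamma : R) (V : S -> R)
    (pi' : S -> U) : Prop :=
  forall (x : S) (pi : S -> U),
    T_policy a0 f h gamma pi V x <= T_policy a0 f h gamma pi' V x.

Definition policy_iteration (R : realType) (S U A : finType) (a0 : A)
    (f : S -> U -> A -> S) (h : S -> R) (gamma : R) (pi0 : S -> U)
    (pi : nat -> S -> U) (V : nat -> S -> R) : Prop :=
  pi 0%N = pi0 /\
  forall k : nat,
    V k = T_policy a0 f h gamma (pi k) (V k) /\
    improving_policy a0 f h gamma (V k) (pi k.+1).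

(* Main.v *)
(* The operators T^pi and T are monotone and satisfy T (V + c) <= T V + gamma c
   for constants c >= 0, so a subsolution V <= T V lies below every
   supersolution W >= T W. Greedy improvement gives
   V_k <= T V_k = T^(pi_(k+1)) V_k, so V_k is a subsolution for pi_(k+1) and
   V_k <= T V_k <= V_(k+1) <= h. The pointwise limit W of this bounded monotone
   sequence satisfies T W = W by passing to the limit in V_k <= T V_k <= V_(k+1). *)
Require Import Defs.
From mathcomp Require Import all_boot all_order all_algebra.
From mathcomp Require Import all_classical all_reals all_analysis.
From mathcomp Require Import lra.
Set Implicit Arguments.
Unset Strict Implicit.
Unset Printing Implicit Defensive.
Import Order.TTheory GRing.Theory Num.Theory.
Import numFieldNormedType.Exports.
Local Open Scope classical_set_scope.
Local Open Scope ring_scope.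

Lemma fin_min_shift (R : realType) (T : finType) (t0 : T) (F G : T -> R) (c : R) :
  (forall t, F t <= G t + c) -> fin_min t0 F <= fin_min t0 G + c.
Proof.
move=> FG.
have [[t <-] _] := (fin_minP t0 G (fin_min t0 G)).1 erefl.
have [_ lb] := (fin_minP t0 F (fin_min t0 F)).1 erefl.
exact: le_trans (lb t) (FG t).
Qed.

Lemma fin_max_shift (R : realType) (T : finType) (t0 : T) (F G : T -> R) (c : R) :
  (forall t, F t <= G t + c) -> fin_max t0 F <= fin_max t0 G + c.
Proof.
move=> FG.
have [[t <-] _] := (fin_maxP t0 F (fin_max t0 F)).1 erefl.
have [_ ub] := (fin_maxP t0 G (fin_max t0 G)).1 erefl.
by apply: le_trans (FG t) _; rewrite lerD2r.
Qed.

(** Since [c >= 0], capping by [a] commutes with the shift up to an inequality: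
    [min a (n + c) <= min a n + c]. *)
Lemma discounted_min_shift (R : realType) (gamma a m n c : R) :
  0 <= gamma -> 0 <= c -> m <= n + c ->
  (1 - gamma) * a + gamma * Order.min a m <=
  (1 - gamma) * a + gamma * Order.min a n + gamma * c.
Proof.
move=> g0 c0 mn; rewrite -addrA lerD2l -mulrDr ler_wpM2l //.
by case: (leP a m) => ?; case: (leP a n) => ?; lra.
Qed.

(** Blackwell's two conditions, monotonicity and discounting, in one: [c = 0] gives the former,
    [V = W + c] the latter. *)
Definition discounted (R : realType) (S : finType) (gamma : R)
    (T : (S -> R) -> S -> R) : Prop :=
  forall (c : R) (V W : S -> R), 0 <= c -> (forall x, V x <= W x + c) ->
    forall x, T V x <= T W x + gamma * c.

Lemma T_policy_discounted (R : realType) (S U A : finType) (a0 : A)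
    (f : S -> U -> A -> S) (h : S -> R) (gamma : R) (pi : S -> U) :
  0 <= gamma -> discounted gamma (T_policy a0 f h gamma pi).
Proof.
move=> g0 c V W c0 VW x.
by apply: discounted_min_shift => //; apply: fin_min_shift => a.
Qed.

Lemma T_safe_discounted (R : realType) (S U A : finType) (u0 : U) (a0 : A)
    (f : S -> U -> A -> S) (h : S -> R) (gamma : R) :
  0 <= gamma -> discounted gamma (T_safe u0 a0 f h gamma).
Proof.
move=> g0 c V W c0 VW x; apply: discounted_min_shift => //.
by apply: fin_max_shift => u; apply: fin_min_shift => a.
Qed.

Lemma discounted_mono (R : realType) (S : finType) (gamma : R)
    (T : (S -> R) -> S -> R) (V W : S -> R) :
  discounted gamma T -> (forall x, V x <= W x) -> forall x, T V x <= T W x.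
Proof.
move=> dT VW x; rewrite -[leRHS]addr0 -(mulr0 gamma).
by apply: dT => // y; rewrite addr0.
Qed.

(** Maximum principle: let [y] maximize [V - W] over the finite [S], and suppose
    [c = V y - W y > 0]. Then [V y <= T V y <= T W y + gamma * c <= W y + gamma * c], so
    [c <= gamma * c], against [gamma < 1]. *)
Lemma discounted_comparison (R : realType) (S : finType) (gamma : R)
    (T : (S -> R) -> S -> R) (V W : S -> R) :
  gamma < 1 -> discounted gamma T ->
  (forall x, V x <= T V x) -> (forall x, T W x <= W x) ->
  forall x, V x <= W x.
Proof.
move=> g1 dT VT TW x.
have [y _ ymax] :=
  @Order.TotalTheory.arg_maxP _ R S x predT (fun z => V z - W z) isT.
have := ymax x isT; rewrite -subr_le0 => /le_trans; apply.
rewrite leNgt; apply/negP => c0.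
have VWc z : V z <= W z + (V y - W y) by have /= := ymax z isT; lra.
have := dT _ _ _ (ltW c0) VWc y.
by have := VT y; have := TW y; nra.
Qed.

Lemma T_policy_le_T_safe (R : realType) (S U A : finType) (u0 : U) (a0 : A)
    (f : S -> U -> A -> S) (h : S -> R) (gamma : R) (pi : S -> U) (V : S -> R)
    (x : S) :
  0 <= gamma -> T_policy a0 f h gamma pi V x <= T_safe u0 a0 f h gamma V x.
Proof.
move=> g0; rewrite -[leRHS]addr0 -(mulr0 gamma).
apply: discounted_min_shift => //; rewrite addr0.
set F := fun u => fin_min a0 (fun a => V (f x u a)).
by have [_] := (fin_maxP u0 F (fin_max u0 F)).1 erefl; apply.
Qed.

Lemma T_safe_le_improving (R : realType) (S U A : finType) (u0 : U) (a0 : A)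
    (f : S -> U -> A -> S) (h : S -> R) (gamma : R) (pi : S -> U) (V : S -> R)
    (x : S) :
  improving_policy a0 f h gamma V pi ->
  T_safe u0 a0 f h gamma V x <= T_policy a0 f h gamma pi V x.
Proof.
move=> imp.
set F := fun u => fin_min a0 (fun a => V (f x u a)).
have [[u uE] _] := (fin_maxP u0 F (fin_max u0 F)).1 erefl.
(* Only the action at [x] matters, so the constant policy at a maximizing [u] is a sufficient
   competitor. *)
by have := imp x (fun=> u); rewrite {1}/T_policy -/(F u) uE.
Qed.

(** Bounds all iterates by a function independent of the policy, which makes the monotone sequence
    converge. *)
Lemma T_policy_le_h (R : realType) (S U A : finType) (a0 : A)
    (f : S -> U -> A -> S) (h : S -> R) (gamma : R) (pi : S -> U) (V : S -> R)
    (x : S) :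
  0 <= gamma -> T_policy a0 f h gamma pi V x <= h x.
Proof.
move=> g0; rewrite /T_policy; set m := fin_min _ _.
have : gamma * Order.min (h x) m <= gamma * h x.
  by rewrite ler_wpM2l // ge_min lexx.
lra.
Qed.

Theorem theorem3 (R : realType) (S U A : finType) (s0 : S) (u0 : U) (a0 : A)
    (f : S -> U -> A -> S) (h : S -> R) (gamma : R)
    (gamma_gt0 : 0 < gamma) (gamma_lt1 : gamma < 1)
    (pi0 : S -> U) (pi : nat -> S -> U) (V : nat -> S -> R)
    (algo : policy_iteration a0 f h gamma pi0 pi V) :
  (forall (k : nat) (x : S), V k x <= V k.+1 x) /\
  (exists Vstar : S -> R,
    [/\ T_safe u0 a0 f h gamma Vstar = Vstar,
        (forall W : S -> R, T_safe u0 a0 f h gamma W = W -> W = Vstar) &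
        {ptws, V @ \oo --> Vstar}]).
Proof.
have g0 := ltW gamma_gt0.
have [_ step] := algo.
have fixV k : V k = T_policy a0 f h gamma (pi k) (V k) by case: (step k).
have impV k : improving_policy a0 f h gamma (V k) (pi k.+1) by case: (step k).
set T := T_safe u0 a0 f h gamma.
have dT : discounted gamma T by exact: T_safe_discounted.
have dP p : discounted gamma (T_policy a0 f h gamma p).
  exact: T_policy_discounted.
have V_le_T k x : V k x <= T (V k) x.
  by rewrite {1}fixV T_policy_le_T_safe.
have T_le_P k x : T (V k) x <= T_policy a0 f h gamma (pi k.+1) (V k) x.
  exact: T_safe_le_improving.
have V_nd k x : V k x <= V k.+1 x.
  apply: (discounted_comparison gamma_lt1 (dP (pi k.+1))) => y.
    exact: le_trans (V_le_T k y) (T_le_P k y).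
  by rewrite -fixV.
split=> //.
have T_le_V k x : T (V k) x <= V k.+1 x.
  apply: le_trans (T_le_P k x) _; rewrite [leRHS](congr1 (@^~ x) (fixV k.+1)).
  by apply: (discounted_mono (dP _)).
have ndV x : nondecreasing_seq (fun k => V k x).
  by apply/nondecreasing_seqP => k.
have cvgV x : cvgn (fun k => V k x).
  apply: nondecreasing_is_cvgn => //; exists (h x) => _ [k _ <-].
  by rewrite fixV T_policy_le_h.
pose W x := limn (fun k => V k x).
have V_le_W k x : V k x <= W x by exact: (nondecreasing_cvgn_le (ndV x) (cvgV x)).
have W_le_T x : W x <= T W x.
  apply: limr_le => //; apply: nearW => k.
  by apply: le_trans (V_le_T k x) _; apply: (discounted_mono dT).
have T_le_W x : T W x <= W x.
  (* The discount inequality replaces continuity of [T]: once [W <= V k + e] everywhere, [T W <= T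
     (V k) + gamma * e <= V k.+1 + gamma * e <= W + e]. *)
  apply/ler_addgt0Pr => e e0.
  have [k kP] : exists k, forall y, W y <= V k y + e.
    have : \forall k \near \oo, forall y, W y <= V k y + e.
      (* Finiteness of [S] makes the pointwise convergence uniform, so one [k] serves every [y]. *)
      apply: filter_forall => y.
      have /cvgr_ge := cvgV y; move=> /(_ (W y - e)).
      rewrite ltrBlDr ltrDl => /(_ e0).
      by apply: filterS => k; rewrite lerBlDr.
    by case=> k _ kP; exists k; apply: kP => /=.
  have := dT _ _ _ (ltW e0) kP x.
  by have := T_le_V k x; have := V_le_W k.+1 x; nra.
exists W; split.
- by apply/funext => x; apply/eqP; rewrite eq_le W_le_T T_le_W.
- move=> W' W'fix; apply/funext => x; apply/eqP; rewrite eq_le.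
  (* A fixed point is both a subsolution and a supersolution, so comparison applies in both
     directions. *)
  by apply/andP; split; apply: (discounted_comparison gamma_lt1 dT) => // y;
    rewrite W'fix.
(* Pointwise convergence is insensitive to the topology put on [S]; the discrete one is chosen. *)
- by apply/(@pointwise_cvgP (discrete_topology S)).
Qed.
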